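(* Consider the $2$-user symmetric linear deterministic Z interference channel with unidirectional, rate-limited transmitter cooperation of capacity $C$ (a nonnegative integer) from transmitter $2$ to transmitter $1$, with integer parameters $m\ge 1$, $n\ge 0$, and suppose $1<\alpha<2$, where $\alpha=n/m$. Then the secrecy capacity region (under the perfect secrecy constraint) is the set of all $(R_1,R_2)$ with $R_1\ge0$, $R_2\ge0$ and $$R_1\le m,\qquad R_2\le 2m-n,\qquad R_1+R_2\le m+C.$$
   Context: Model: let $q=\max\{m,n\}$ and let $\mathbf{D}$ be the $q\times q$ downshift matrix over $\mathbb{F}_2$ (entries $d_{j',j''}=1$ if $2\le j'=j''+1\le q$, and $0$ otherwise). At each channel use, transmitter $i$ sends $\mathbf{x}_i\in\mathbb{F}_2^q$, and the outputs are $\mathbf{y}_1=\mathbf{D}^{q-m}\mathbf{x}_1\oplus\mathbf{D}^{q-n}\mathbf{x}_2$ and $\mathbf{y}_2=\mathbf{D}^{q-m}\mathbf{x}_2$, where $\oplus$ is componentwise addition mod $2$. Transmitter $i$ has a message $W_i$ uniform on $\{1,\dots,2^{NR_i}\}$ ($N$ = block length, rates in bits per channel use). Transmitter $2$ can send to transmitter $1$, over a noiseless secure link, at most $C$ bits per channel use; transmitter $2$'s signal depends only on $W_2$ (and possibly its own randomness), while transmitter $1$'s signal at each time is a function of $W_1$, the bits received so far over the cooperative link (causality), and possibly locally generated random bits. Receiver $i$ decodes $W_i$ from $\mathbf{y}_i^N$. A rate pair is achievable with perfect secrecy if there are such codes with decoding error probability tending to $0$ as $N\to\infty$ and $I(W_i;\mathbf{y}_j^N)=0$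 for $i\neq j$. The secrecy capacity region is the closure of the set of achievable rate pairs. *)

(* Defs.v *)
From HB Require Import structures.
From mathcomp Require Import all_boot all_order all_algebra.
From mathcomp Require Import all_classical all_reals all_analysis.
Set Implicit Arguments. Unset Strict Implicit. Unset Printing Implicit Defensive.
Import Order.TTheory GRing.Theory Num.Theory.
Import numFieldNormedType.Exports.
Local Open Scope ring_scope.

Notation sym q := 'cV['F_2]_q.

Definition downshift (q : nat) : 'M['F_2]_q :=
  \matrix_(i < q, j < q) (if (i : nat) == j.+1 then 1 else 0).

Definition mxpow (q k : nat) (A : 'M['F_2]_q) : 'M['F_2]_q :=
  iter k (mulmx A) 1%:M.

Definition qmax (m n : nat) : nat := maxn m n.

Definition out1 (m n : nat) (x1 x2 : sym (qmax m n)) : sym (qmax m n) :=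
  mxpow (qmax m n - m) (downshift (qmax m n)) *m x1
  + mxpow (qmax m n - n) (downshift (qmax m n)) *m x2.
Definition out2 (m n : nat) (x2 : sym (qmax m n)) : sym (qmax m n) :=
  mxpow (qmax m n - m) (downshift (qmax m n)) *m x2.

Definition is_distr (R : realType) (T : finType) (P : T -> R) : Prop :=
  (forall t, 0 <= P t) /\ \sum_(t : T) P t = 1.

(* A block-length-N code with M1, M2 messages, for cooperative link of
   C bits per channel use (a link symbol per time is an element of 'I_(2^C)). *)
Unset Implicit Arguments.
Record code (R : realType) (m n C N M1 M2 : nat) := Code {
  rnd1 : finType;
  rnd2 : finType;
  P1 : rnd1 -> R;
  P2 : rnd2 -> R;
  enc2 : 'I_M2 -> rnd2 -> 'I_N -> sym (qmax m n);
  conf : 'I_M2 -> rnd2 -> 'I_N -> 'I_(2 ^ C);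
  (* Tx 1 signal at time t: function of W1, its randomness, and the link
     symbols (only those received so far may be used, see [causal]) *)
  enc1 : 'I_M1 -> rnd1 -> 'I_N -> ('I_N -> 'I_(2 ^ C)) -> sym (qmax m n);
  dec1 : {ffun 'I_N -> sym (qmax m n)} -> 'I_M1;
  dec2 : {ffun 'I_N -> sym (qmax m n)} -> 'I_M2
}.
Set Implicit Arguments.
Arguments rnd1 {R m n C N M1 M2}.
Arguments rnd2 {R m n C N M1 M2}.
Arguments P1 {R m n C N M1 M2}.
Arguments P2 {R m n C N M1 M2}.
Arguments enc1 {R m n C N M1 M2}.
Arguments enc2 {R m n C N M1 M2}.
Arguments conf {R m n C N M1 M2}.
Arguments dec1 {R m n C N M1 M2}.
Arguments dec2 {R m n C N M1 M2}.

Definition causal (R : realType) m n C N M1 M2 (c : code R m n C N M1 M2) : Prop :=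
  forall w1 r1 (t : 'I_N) (f g : 'I_N -> 'I_(2 ^ C)),
    (forall s : 'I_N, (s <= t)%N -> f s = g s) ->
    enc1 c w1 r1 t f = enc1 c w1 r1 t g.

Definition valid_code (R : realType) m n C N M1 M2 (c : code R m n C N M1 M2) : Prop :=
  is_distr (P1 c) /\ is_distr (P2 c) /\ causal c.

Section CodeSemantics.
Variables (R : realType) (m n C N M1 M2 : nat) (c : code R m n C N M1 M2).

Definition omega : finType := ('I_M1 * 'I_M2 * rnd1 c * rnd2 c)%type.

Definition prob (o : omega) : R :=
  let: (w1, w2, r1, r2) := o in
  (M1%:R)^-1 * (M2%:R)^-1 * P1 c r1 * P2 c r2.

Definition W1 (o : omega) : 'I_M1 := o.1.1.1.
Definition W2 (o : omega) : 'I_M2 := o.1.1.2.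

Definition X1 (o : omega) (t : 'I_N) : sym (qmax m n) :=
  let: (w1, w2, r1, r2) := o in enc1 c w1 r1 t (conf c w2 r2).
Definition X2 (o : omega) (t : 'I_N) : sym (qmax m n) :=
  let: (w1, w2, r1, r2) := o in enc2 c w2 r2 t.

Definition Y1 (o : omega) : {ffun 'I_N -> sym (qmax m n)} :=
  [ffun t => @out1 m n (X1 o t) (X2 o t)].
Definition Y2 (o : omega) : {ffun 'I_N -> sym (qmax m n)} :=
  [ffun t => @out2 m n (X2 o t)].

Definition err_prob : R :=
  \sum_(o : omega | (dec1 c (Y1 o) != W1 o) || (dec2 c (Y2 o) != W2 o)) prob o.

End CodeSemantics.

Definition log2 (R : realType) (x : R) : R := ln x / ln 2.

Definition mutual_info (R : realType) (S A B : finType) (p : S -> R)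
    (X : S -> A) (Y : S -> B) : R :=
  let pXY a b := \sum_(s | (X s == a) && (Y s == b)) p s in
  let pX a := \sum_(s | X s == a) p s in
  let pY b := \sum_(s | Y s == b) p s in
  \sum_(a : A) \sum_(b : B)
     (if pXY a b == 0 then 0 else pXY a b * log2 (pXY a b / (pX a * pY b))).

Definition achievable (R : realType) (m n C : nat) (r : R * R) : Prop :=
  0 <= r.1 /\ 0 <= r.2 /\
  forall eps : R, 0 < eps ->
  exists N0 : nat, forall N : nat, (N0 <= N)%N ->
  exists M1 M2 : nat, exists c : code R m n C N M1 M2,
    valid_code c /\
    powR 2 (N%:R * r.1) <= M1%:R /\ powR 2 (N%:R * r.2) <= M2%:R /\
    err_prob c <= eps /\
    mutual_info (@prob R m n C N M1 M2 c) (@W1 R m n C N M1 M2 c) (@Y2 R m n C N M1 M2 c) = 0 /\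
    mutual_info (@prob R m n C N M1 M2 c) (@W2 R m n C N M1 M2 c) (@Y1 R m n C N M1 M2 c) = 0.

Definition secrecy_capacity_region (R : realType) (m n C : nat) : set (R * R) :=
  @closure (R * R)%type [set r : R * R | @achievable R m n C r].

(* Main.v *)
Require Import Defs.
From HB Require Import structures.
From mathcomp Require Import all_boot all_order all_algebra.
From mathcomp Require Import all_classical all_reals all_analysis.
From mathcomp Require Import zify ring lra.
Import Order.TTheory GRing.Theory Num.Theory.
Import numFieldNormedType.Exports.
Local Open Scope ring_scope.

(* Put d = n - m and k = 2m - n. Receiver 1 sees the top d levels of x_2 in the
   clear and the other levels added to the top m levels of x_1; receiver 2 sees
   the top m levels of x_2.

   Converse, by counting instead of Fano's inequality. Let P be the probability
   that both receivers decode. Given x_2, the output y_1 takes 2^(Nm) values, so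
   P <= 2^(Nm) / M_1. Of the m levels seen by receiver 2, d are functions of y_1,
   which is independent of W_2, so P <= 2^(Nk) / M_2. For the sum rate, the
   ratios Pr(y_1) / Pr(x_2) and Pr(x_2) / Pr(y_1), integrated over the events
   that W_1, respectively W_2, is decoded, give at most 2^(NC) / M_1 and
   2^(Nm) / M_2: the first because (W_1, link, y_1) determines x_2 up to the
   randomness of transmitter 1, the second by secrecy. The ratios being inverse
   to each other, P^2 <= 2^(N(m+C)) / (M_1 M_2).

   Achievability, without error. Transmitter 2 sends data on c = min(C, k) of
   the levels d, ..., m - 1, which transmitter 1 learns over the link and cancels
   at receiver 1. During the first J channel uses it also sends data on the
   remaining k - c of these levels, and transmitter 1 covers them with uniform
   noise instead of its own data. Varying J gives all rate pairs. *)

(** * The channel read level by level *)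

Definition level {q : nat} (x : sym q) (i : nat) : 'F_2 :=
  if insub i is Some j then x j 0 else 0.

Lemma level_ord q (x : sym q) (i : 'I_q) : level x i = x i 0.
Proof. by rewrite /level valK. Qed.

Lemma level_out q (x : sym q) i : (q <= i)%N -> level x i = 0.
Proof. by move=> qi; rewrite /level insubF // ltnNge qi. Qed.

Lemma level_inj q (x y : sym q) :
  (forall i, (i < q)%N -> level x i = level y i) -> x = y.
Proof.
move=> xy; apply/matrixP => i j; rewrite (ord1 j).
by rewrite -!level_ord xy.
Qed.

Lemma levelD q (x y : sym q) i : level (x + y) i = level x i + level y i.
Proof. by rewrite /level; case: insubP => [j _ _|_]; rewrite ?mxE ?addr0. Qed.

Definition column {q : nat} (f : nat -> 'F_2) : sym q := \col_(j < q) f j.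

Lemma level_column q (f : nat -> 'F_2) i : (i < q)%N ->
  level (@column q f) i = f i.
Proof. by move=> iq; rewrite /level insubT mxE. Qed.

Lemma level_downshift q (x : sym q) i :
  level (downshift q *m x) i = if (0 < i < q)%N then level x i.-1 else 0.
Proof.
have [iq|qi] := ltnP i q; last by rewrite andbF level_out.
rewrite andbT (level_ord _ (downshift q *m x) (Ordinal iq)) mxE /=.
under eq_bigr => j _ do rewrite mxE /=.
case: i iq => [|i] iq /=; first by rewrite big1 // => j _; rewrite mul0r.
have iq' : (i < q)%N by apply: ltnW.
rewrite (bigD1 (Ordinal iq')) //= eqxx mul1r big1 ?addr0 => [|j].
  by rewrite -(level_ord _ x (Ordinal iq')).
rewrite -val_eqE /= eqSS => /negPf; rewrite eq_sym => ->.
by rewrite mul0r.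
Qed.

Lemma level_mxpow_downshift q k (x : sym q) i :
  level (mxpow k (downshift q) *m x) i =
  if (k <= i < q)%N then level x (i - k) else 0.
Proof.
elim: k i => [|k IH] i.
  rewrite /mxpow /= mul1mx subn0.
  by case: ltnP => // qi; rewrite level_out.
rewrite /mxpow iterS -mulmxA level_downshift -/(mxpow k _) IH.
case: i => [|i] //=; rewrite subSS ltnS.
by have [iq|qi] := ltnP i.+1 q; rewrite ?andbF ?(ltnW iq).
Qed.

Lemma qmaxE {m n} : (m < n)%N -> qmax m n = n.
Proof. by move=> mn; apply/maxn_idPr/ltnW. Qed.

Lemma level_out1 {m n} (x1 x2 : sym (qmax m n)) i : (m < n)%N ->
  level (out1 x1 x2) i =
  (if (n - m <= i < n)%N then level x1 (i - (n - m)) else 0) + level x2 i.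
Proof.
move=> mn; rewrite /out1 levelD !level_mxpow_downshift.
have [-> -> ltE] : [/\ (qmax m n - m = n - m)%N, (qmax m n - n = 0)%N &
    (i < qmax m n)%N = (i < n)%N] by rewrite qmaxE // subnn.
rewrite ltE subn0 /=; congr (_ + _).
by case: ltnP => // ni; rewrite level_out // qmaxE.
Qed.

Lemma level_out2 {m n} (x2 : sym (qmax m n)) i : (m < n)%N ->
  level (out2 x2) i =
  if (n - m <= i < n)%N then level x2 (i - (n - m)) else 0.
Proof.
move=> mn; rewrite /out2 level_mxpow_downshift.
have [-> -> //] : (qmax m n - m = n - m)%N /\
    (i < qmax m n)%N = (i < n)%N by rewrite qmaxE.
Qed.

(** Only the levels from [e] on remain free, and they amount to [N * (q - e)] bits. *)
Lemma card_prescribed_prefix {q N} e (a : 'I_N -> nat -> 'F_2) :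
  (#|[pred y : {ffun 'I_N -> sym q} |
       [forall t, forall i : 'I_q, (i < e) ==> (level (y t) i == a t i)]]|
   <= 2 ^ (N * (q - e)))%N.
Proof.
set A := [pred y | _].
pose f (y : {ffun 'I_N -> sym q}) : {ffun 'I_N * 'I_(q - e) -> 'F_2} :=
  [ffun p : _ * 'I_(q - e) => level (y p.1) (e + p.2)].
have finj : {in A &, injective f}.
  move=> y z /forallP Ay /forallP Az /ffunP fyz; apply/ffunP => t.
  apply: level_inj => i iq; have [ie|ei] := ltnP i e.
    have /forallP/(_ (Ordinal iq)) := Ay t; have /forallP/(_ (Ordinal iq)) := Az t.
    by rewrite /= ie /= => /eqP -> /eqP ->.
  have ieq : (i - e < q - e)%N by rewrite ltn_sub2r // (leq_ltn_trans ei).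
  by have := fyz (t, Ordinal ieq); rewrite !ffunE /= subnKC.
rewrite -(card_in_image finj) (leq_trans (max_card _)) //.
by rewrite card_ffun card_prod !card_ord Fp_cast.
Qed.

(** * Zero mutual information and independence *)

Lemma mutual_info0_indep {R : realType} {S A B : finType} {p : S -> R}
    {X : S -> A} {Y : S -> B} :
  (forall s, 0 <= p s) -> \sum_s p s = 1 -> mutual_info p X Y = 0 ->
  forall a b, \sum_(s | (X s == a) && (Y s == b)) p s =
    (\sum_(s | X s == a) p s) * (\sum_(s | Y s == b) p s).
Proof.
move=> p0 p1; rewrite /mutual_info.
set pX := fun a => \sum_(s | X s == a) p s.
set pY := fun b => \sum_(s | Y s == b) p s.
set pXY := fun a b => \sum_(s | (X s == a) && (Y s == b)) p s.
move=> I0 a b; rewrite -/(pXY a b) -/(pX a) -/(pY b).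
have pXY0 a' b' : 0 <= pXY a' b' by apply: sumr_ge0.
have pXYX a' b' : pXY a' b' <= pX a'.
  by rewrite /pX (bigID (fun s => Y s == b')) /= lerDl sumr_ge0.
have pXYY a' b' : pXY a' b' <= pY b'.
  rewrite /pY (bigID (fun s => X s == a')) /=.
  under eq_bigl => s do rewrite andbC.
  by rewrite lerDl sumr_ge0.
have ln2 : 0 < ln 2 :> R by rewrite ln_gt0 ?ltr1n.
(* [F] is a summand of the mutual information, in nats, minus [pXY a' b' - pX a' * pY b']. Both
   parts sum to 0, while [F] is nonnegative and vanishes only where the joint law is the product. *)
pose F a' b' := (if pXY a' b' == 0 then 0 else
  pXY a' b' * log2 (pXY a' b' / (pX a' * pY b'))) * ln 2
  - (pXY a' b' - pX a' * pY b').
(* ln u < u - 1 unless u = 1, here for u = pX * pY / pXY *)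
have F_gt a' b' : pXY a' b' != pX a' * pY b' -> 0 < F a' b'.
  rewrite /F; case: (eqVneq (pXY a' b') 0) => [->|pn0].
    rewrite mul0r sub0r opprB subr0 eq_sym lt_def => -> /=.
    by rewrite mulr_ge0 ?sumr_ge0.
  have pgt : 0 < pXY a' b' by rewrite lt_def pn0 pXY0.
  have pX_gt := lt_le_trans pgt (pXYX a' b').
  have pY_gt := lt_le_trans pgt (pXYY a' b').
  set z := pX a' * pY b' => neq.
  have z_gt : 0 < z by rewrite mulr_gt0.
  rewrite /log2 mulrA divfK ?gt_eqF // -[_ / z]invrK invf_div.
  rewrite lnV ?posrE ?divr_gt0 //.
  set u := z / _.
  have u1 : u != 1.
    apply: contra neq => /eqP uE.
    by rewrite -[z](divfK pn0) -/u uE mul1r.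
  have ln_lt : ln u < u - 1.
    rewrite -ltr_expR lnK ?posrE ?divr_gt0 //.
    have := @expR_gt1Dx R (u - 1); rewrite addrCA subrr addr0; apply.
    by rewrite subr_eq0.
  have -> : z = u * pXY a' b' by rewrite divfK.
  have : 0 < pXY a' b' * (u - 1 - ln u) by rewrite mulr_gt0 // subr_gt0.
  by congr (0 < _); ring.
have F_ge a' b' : 0 <= F a' b'.
  have [eqz|/F_gt/ltW//] := eqVneq (pXY a' b') (pX a' * pY b').
  rewrite /F; case: (eqVneq (pXY a' b') 0) => [p00|pn0].
    by rewrite -eqz p00 mul0r subrr.
  by rewrite eqz divff -?eqz // /log2 ln1 mul0r mulr0 mul0r subrr.
have sumXY : \sum_a' \sum_b' pXY a' b' = 1.
  rewrite -p1 (partition_big X xpredT) //=; apply: eq_bigr => a' _.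
  by rewrite (partition_big Y xpredT).
have sumX : \sum_a' pX a' = 1 by rewrite -p1 (partition_big X xpredT).
have sumY : \sum_b' pY b' = 1 by rewrite -p1 (partition_big Y xpredT).
have sumF : \sum_a' \sum_b' F a' b' = 0.
  under eq_bigr => a' _ do rewrite sumrB -mulr_suml sumrB -mulr_sumr sumY mulr1.
  by rewrite sumrB -mulr_suml I0 mul0r sumrB sumXY sumX !subrr.
apply/eqP/negPn/negP => /F_gt Fgt.
suff : 0 < \sum_a' \sum_b' F a' b' by rewrite sumF ltxx.
rewrite (bigD1 a) //= ltr_pwDl //; last by apply: sumr_ge0 => *; apply: sumr_ge0.
by rewrite (bigD1 b) //= ltr_pwDl // sumr_ge0.
Qed.

Lemma indep_mutual_info0 {R : realType} {S A B : finType} {p : S -> R}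
    {X : S -> A} {Y : S -> B} :
  (forall a b, \sum_(s | (X s == a) && (Y s == b)) p s =
    (\sum_(s | X s == a) p s) * (\sum_(s | Y s == b) p s)) ->
  mutual_info p X Y = 0.
Proof.
move=> indep; rewrite /mutual_info big1 // => a _; rewrite big1 // => b _.
case: ifPn => // n0; rewrite -indep divff //.
by rewrite /log2 ln1 mul0r mulr0.
Qed.

Lemma sum_card_const {R : pzSemiRingType} {T : finType} (A : {pred T}) (x : R) :
  \sum_(i in A) x = #|A|%:R * x.
Proof. by rewrite sumr_const mulr_natl. Qed.

(** * Converse bounds for a single code *)

Section Converse.
Context {R : realType} {m n C N M1 M2 : nat} {c : Defs.code R m n C N M1 M2}.
Hypotheses (lt_mn : (m < n)%N) (c_valid : valid_code c).
Hypotheses (M1_gt0 : (0 < M1)%N) (M2_gt0 : (0 < M2)%N).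

Local Notation q := (qmax m n).
Local Notation p := (@prob R m n C N M1 M2 c).
Local Notation w1_of := (@W1 R m n C N M1 M2 c).
Local Notation w2_of := (@W2 R m n C N M1 M2 c).
Local Notation y1_of := (@Y1 R m n C N M1 M2 c).
Local Notation y2_of := (@Y2 R m n C N M1 M2 c).
Local Notation block := {ffun 'I_N -> sym q}.

Definition inputs2 (o : omega c) : block := [ffun t => X2 o t].
Definition law_Y1 (y : block) : R := \sum_(o | y1_of o == y) p o.
Definition law_X2 (x : block) : R := \sum_(o | inputs2 o == x) p o.

Lemma sum_omega (F : omega c -> R) :
  \sum_o F o = \sum_w1 \sum_w2 \sum_r1 \sum_r2 F (w1, w2, r1, r2).
Proof.
rewrite pair_bigA pair_bigA /= pair_bigA /=.
by apply: eq_bigr => -[[[w1 w2] r1] r2] _.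
Qed.

Let P1_ge0 r : 0 <= P1 c r. Proof. by have [[]] := c_valid. Qed.
Let P1_sum : \sum_r P1 c r = 1. Proof. by have [[]] := c_valid. Qed.
Let P2_ge0 r : 0 <= P2 c r. Proof. by have [_ [[]]] := c_valid. Qed.
Let P2_sum : \sum_r P2 c r = 1. Proof. by have [_ [[]]] := c_valid. Qed.

Lemma prob_ge0 o : 0 <= p o.
Proof. by case: o => [[[w1 w2] r1] r2] /=; rewrite !mulr_ge0 ?invr_ge0. Qed.

Lemma prob_W2 w : \sum_(o | w2_of o == w) p o = M2%:R^-1.
Proof.
rewrite big_mkcond sum_omega /=.
under eq_bigr => w1 _.
  rewrite (bigD1 w) //= [X in _ + X]big1 ?addr0.
    under eq_bigr => r1 _ do rewrite /W2 /= eqxx -mulr_sumr P2_sum mulr1.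
    rewrite -mulr_sumr P1_sum mulr1; over.
  by move=> w2 /negPf w2w; rewrite big1 // => r1 _; rewrite big1 // => r2 _;
    rewrite /W2 /= w2w.
rewrite /= sum_card_const card_ord mulrA divff ?mul1r //.
by rewrite pnatr_eq0 -lt0n.
Qed.

Lemma prob_sum1 : \sum_o p o = 1.
Proof.
rewrite (partition_big w2_of xpredT) //=.
under eq_bigr => w _ do rewrite prob_W2.
rewrite sum_card_const card_ord divff //.
by rewrite pnatr_eq0 -lt0n.
Qed.

Lemma law_Y1_ge0 y : 0 <= law_Y1 y.
Proof. by apply: sumr_ge0 => o _; apply: prob_ge0. Qed.

Lemma law_X2_ge0 x : 0 <= law_X2 x.
Proof. by apply: sumr_ge0 => o _; apply: prob_ge0. Qed.

Lemma law_Y1_sum1 : \sum_y law_Y1 y = 1.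
Proof. by rewrite -prob_sum1 (partition_big y1_of xpredT). Qed.

Lemma law_X2_sum1 : \sum_x law_X2 x = 1.
Proof. by rewrite -prob_sum1 (partition_big inputs2 xpredT). Qed.

Lemma Y1_prefix o t i : (i < n - m)%N ->
  level (y1_of o t) i = level (inputs2 o t) i.
Proof.
by move=> id; rewrite !ffunE level_out1 // leqNgt id add0r.
Qed.

Lemma Y2_prefix o t i : (i < n)%N -> (i < 2 * (n - m))%N ->
  level (y2_of o t) i =
  if (n - m <= i)%N then level (y1_of o t) (i - (n - m)) else 0.
Proof.
move=> ni id; rewrite ffunE level_out2 // ni andbT; case: leqP => // di.
rewrite Y1_prefix ?ffunE //; lia.
Qed.

Definition same_prefix (y x : block) :=
  [forall t, forall i : 'I_q, (i < n - m)%N ==> (level (y t) i == level (x t) i)].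

Lemma card_same_prefix x : (#|[pred y | same_prefix y x]| <= 2 ^ (N * m))%N.
Proof.
have := card_prescribed_prefix (q := q) (n - m) (fun t => level (x t)).
by rewrite (_ : (q - (n - m) = m)%N) // qmaxE // subKn // ltnW.
Qed.

Lemma same_prefixP o : same_prefix (y1_of o) (inputs2 o).
Proof.
apply/forallP => t; apply/forallP => i; apply/implyP => id.
by rewrite Y1_prefix.
Qed.

(* The 2d top levels of y_2 are d zeros and the top d levels of y_1. *)
Definition clear_part (y1 y2 : block) :=
  [forall t, forall i : 'I_q, (i < 2 * (n - m))%N ==> (level (y2 t) i ==
    if (n - m <= i)%N then level (y1 t) (i - (n - m)) else 0)].

Lemma card_clear_part y1 :
  (#|[pred y2 | clear_part y1 y2]| <= 2 ^ (N * (2 * m - n)))%N.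
Proof.
have := card_prescribed_prefix (q := q) (N := N) (2 * (n - m))
  (fun t i => if (n - m <= i)%N then level (y1 t) (i - (n - m)) else 0).
rewrite (_ : (q - 2 * (n - m) = 2 * m - n)%N) // qmaxE //; lia.
Qed.

Lemma clear_partP o : clear_part (y1_of o) (y2_of o).
Proof.
apply/forallP => t; apply/forallP => i; apply/implyP => id.
by rewrite Y2_prefix //; have := ltn_ord i; rewrite {2}qmaxE.
Qed.

(** Fix [w2], [r1] and [r2], hence x_2. The messages [w1] that are decoded correctly give distinct
    y_1, all with the top d levels of x_2, so there are at most 2^(Nm) of them, each of weight 1 /
    M_1. *)
Lemma decoded1_le :
  \sum_(o | dec1 c (y1_of o) == w1_of o) p o <= 2 ^+ (N * m) / M1%:R.
Proof.
rewrite big_mkcond sum_omega exchange_big /=.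
apply: (@le_trans _ _ (\sum_(w2 < M2) \sum_r1 \sum_r2
  M2%:R^-1 * P1 c r1 * P2 c r2 * (2 ^+ (N * m) / M1%:R))); last first.
  under eq_bigr => w2 _.
    under eq_bigr => r1 _ do rewrite -mulr_suml -mulr_sumr P2_sum mulr1.
    rewrite -mulr_suml -mulr_sumr P1_sum mulr1; over.
  rewrite -mulr_suml sum_card_const card_ord divff ?mul1r //.
  by rewrite pnatr_eq0 -lt0n.
apply: ler_sum => w2 _; rewrite exchange_big; apply: ler_sum => r1 _.
rewrite exchange_big; apply: ler_sum => r2 _.
rewrite -big_mkcond /= -big_distrl /= -big_distrl /= -big_distrl /=.
rewrite sum_card_const.
set A := #|_|; suff leA : A%:R <= 2 ^+ (N * m) :> R.
  rewrite [leLHS](_ : _ = M2%:R^-1 * P1 c r1 * P2 c r2 * (A%:R / M1%:R)); last ring.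
  by rewrite ler_wpM2l ?mulr_ge0 ?invr_ge0 // ler_wpM2r ?invr_ge0.
rewrite -natrX ler_nat.
pose x : block := [ffun t => enc2 c w2 r2 t].
pose f w1 : block := y1_of (w1, w2, r1, r2).
apply: leq_trans (card_same_prefix x).
rewrite /A -(@card_in_image _ _ f) => [|w w'].
  apply: subset_leq_card; apply/fintype.subsetP => y /fintype.imageP [w _ ->].
  by rewrite inE /=; apply: (same_prefixP (w, w2, r1, r2)).
move=> /eqP decw /eqP decw' fww'.
apply: val_inj; apply: etrans (esym decw) (etrans _ decw').
by rewrite -/(f w) -/(f w') fww'.
Qed.

Section Secrecy.
Hypothesis secret : mutual_info p w2_of y1_of = 0.

(** The actual value of [Z] is replaced by a sum over all [z] compatible with y_1. For each of them
    [g z] is one fixed message, which by secrecy has conditional probability 1 / M_2 whatever y_1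
    is. *)
Lemma secrecy_bound (T : finType) (rel : block -> T -> bool) (g : T -> 'I_M2)
    (Z : omega c -> T) (f : block -> T -> R) :
  (forall o, rel (y1_of o) (Z o)) -> (forall y z, 0 <= f y z) ->
  \sum_(o | g (Z o) == w2_of o) p o * f (y1_of o) (Z o) <=
  M2%:R^-1 * \sum_y \sum_(z | rel y z) law_Y1 y * f y z.
Proof.
move=> relZ f0.
apply: (@le_trans _ _ (\sum_o \sum_(z | rel (y1_of o) z && (w2_of o == g z))
   p o * f (y1_of o) z)).
  rewrite big_mkcond; apply: ler_sum => o _.
  have t0 z : 0 <= p o * f (y1_of o) z by rewrite mulr_ge0 ?prob_ge0.
  case: ifPn => [gz|_]; last exact: sumr_ge0.
  rewrite (bigD1 (Z o)) ?relZ ?[_ == g _]eq_sym //=.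
  by rewrite lerDl sumr_ge0.
rewrite (partition_big y1_of xpredT) //= mulr_sumr; apply: ler_sum => y _.
under eq_bigr => o /eqP -> do [].
rewrite (exchange_big_dep (rel y)) /= => [|o z _ /andP[]//].
rewrite mulr_sumr; apply: ler_sum => z yz.
rewrite -big_distrl /= mulrA ler_wpM2r //.
under eq_bigl => o do rewrite yz /= andbC.
by rewrite (mutual_info0_indep prob_ge0 prob_sum1 secret) prob_W2.
Qed.

(** [Z] is y_2 and [f] is 1: every y_1 leaves at most 2^(Nk) candidates for y_2. *)
Lemma decoded2_le : \sum_(o | dec2 c (y2_of o) == w2_of o) p o <=
  2 ^+ (N * (2 * m - n)) / M2%:R.
Proof.
rewrite (eq_bigr (fun o => p o * 1)) => [|o _]; last by rewrite mulr1.
apply: le_trans (@secrecy_bound _ clear_part (dec2 c) y2_of (fun _ _ => 1)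
  clear_partP (fun _ _ => ler01)) _.
rewrite mulrC ler_wpM2r ?invr_ge0 //.
rewrite -[leRHS]mul1r -[X in _ <= X * _]law_Y1_sum1 mulr_suml.
apply: ler_sum => y _.
under eq_bigr => z _ do rewrite mulr1.
rewrite sum_card_const mulrC ler_wpM2l ?law_Y1_ge0 //.
by rewrite -natrX ler_nat card_clear_part.
Qed.

(** [Z] is x_2, of which y_2 is a function. The weight of y_1 in [secrecy_bound] cancels the
    denominator, and every x_2 is compatible with at most 2^(Nm) outputs y_1. *)
Lemma ratio2_le :
  \sum_(o | dec2 c (y2_of o) == w2_of o)
     p o * (law_X2 (inputs2 o) / law_Y1 (y1_of o)) <= 2 ^+ (N * m) / M2%:R.
Proof.
pose g (x : block) := dec2 c [ffun t => out2 (x t)].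
have gE o : g (inputs2 o) = dec2 c (y2_of o).
  by congr (dec2 c _); apply/ffunP => t; rewrite !ffunE.
under eq_bigl => o do rewrite -gE.
apply: le_trans (@secrecy_bound _ same_prefix g inputs2
  (fun y x => law_X2 x / law_Y1 y) same_prefixP _) _.
  by move=> y x; rewrite mulr_ge0 ?invr_ge0 ?law_X2_ge0 ?law_Y1_ge0.
rewrite mulrC ler_wpM2r ?invr_ge0 //.
rewrite (exchange_big_dep xpredT) //=.
rewrite -[leRHS]mul1r -[X in _ <= X * _]law_X2_sum1 mulr_suml.
apply: ler_sum => x _.
apply: (@le_trans _ _ (\sum_(y | same_prefix y x) law_X2 x)).
  apply: ler_sum => y _; have [->|y0] := eqVneq (law_Y1 y) 0.
    by rewrite mul0r law_X2_ge0.
  by rewrite mulrC divfK.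
rewrite sum_card_const mulrC ler_wpM2l ?law_X2_ge0 //.
by rewrite -natrX ler_nat card_same_prefix.
Qed.

End Secrecy.

(** Fix [w1], [r1] and the link symbols [l]. The pairs (w_2, r_2) that yield [l] and a signal x have
    total weight at most [law_X2 x], which cancels the denominator. As y_1 is then injective in x,
    what remains is at most the mass of the outputs decoded as [w1]. Summing over [l] costs 2^(NC),
    and summing over [w1] gives total mass 1. *)
Lemma ratio1_le :
  \sum_(o | dec1 c (y1_of o) == w1_of o)
     p o * (law_Y1 (y1_of o) / law_X2 (inputs2 o)) <= 2 ^+ (N * C) / M1%:R.
Proof.
pose xf (v : 'I_M2 * rnd2 c) : block := [ffun t => enc2 c v.1 v.2 t].
pose lf (v : 'I_M2 * rnd2 c) := [ffun t => conf c v.1 v.2 t].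
pose yf w1 r1 (l : {ffun 'I_N -> 'I_(2 ^ C)}) (x : block) : block :=
  [ffun t => out1 (enc1 c w1 r1 t l) (x t)].
have yfE w1 w2 r1 r2 :
    y1_of (w1, w2, r1, r2) = yf w1 r1 (lf (w2, r2)) (xf (w2, r2)).
  apply/ffunP => t; rewrite !ffunE; congr (out1 _ _).
  (* Causality acts as extensionality here: [lf] agrees with the link function only pointwise. *)
  by apply: c_valid.2.2 => s _; rewrite ffunE.
(* Since q = n, x_2 enters y_1 unshifted and can be subtracted back. *)
have yf_inj w1 r1 l : injective (yf w1 r1 l).
  move=> x x' /ffunP e; apply/ffunP => t; have := e t; rewrite !ffunE.
  move=> et; apply: level_inj => i iq; have := congr1 (level^~ i) et.
  by rewrite !level_out1 // => /addrI.
have law_X2E x : law_X2 x = \sum_(v | xf v == x) M2%:R^-1 * P2 c v.2.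
  rewrite /law_X2 big_mkcond sum_omega /=.
  rewrite [RHS]big_mkcond -(pair_bigA _ (fun w2 r2 =>
    if xf (w2, r2) == x then M2%:R^-1 * P2 c r2 else 0)) /=.
  under eq_bigr => w1 _.
    under eq_bigr => w2 _ do rewrite exchange_big /=.
    under eq_bigr => w2 _.
      under eq_bigr => r2 _.
        under eq_bigr => r1 _.
          rewrite (_ : (if _ then _ else _) = P1 c r1 * (M1%:R^-1 *
            if xf (w2, r2) == x then M2%:R^-1 * P2 c r2 else 0)).
            over.
          have -> : inputs2 (w1, w2, r1, r2) = xf (w2, r2) by [].
          by case: ifP => _; [ring|rewrite !mulr0].
        rewrite -mulr_suml P1_sum mul1r; over.
      rewrite -mulr_sumr; over.
    rewrite -mulr_sumr; over.
  rewrite /= sum_card_const card_ord mulrA divff ?mul1r //.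
  by rewrite pnatr_eq0 -lt0n.
have main w1 r1 :
    \sum_(v | dec1 c (yf w1 r1 (lf v) (xf v)) == w1) M2%:R^-1 * P2 c v.2 *
      (law_Y1 (yf w1 r1 (lf v) (xf v)) / law_X2 (xf v)) <=
    2 ^+ (N * C) * \sum_(y | dec1 c y == w1) law_Y1 y.
  rewrite (partition_big lf xpredT) //=.
  have -> : 2 ^+ (N * C) = #|{ffun 'I_N -> 'I_(2 ^ C)}|%:R :> R.
    by rewrite card_ffun !card_ord -expnM mulnC natrX.
  rewrite -sum_card_const; apply: ler_sum => l _.
  rewrite (partition_big xf xpredT) //= [leRHS]big_mkcond.
  rewrite [leRHS](reindex_inj (yf_inj w1 r1 l)) /=; apply: ler_sum => x _.
  rewrite [leLHS](eq_bigr (fun v => M2%:R^-1 * P2 c v.2 *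
    (law_Y1 (yf w1 r1 l x) / law_X2 x))); last first.
    by move=> v /andP[/andP[_ /eqP ->] /eqP ->].
  rewrite -mulr_suml; case: ifPn => [_|bad]; last first.
    rewrite big_pred0 ?mul0r // => v; apply/negbTE/negP.
    by move=> /andP[/andP[+ /eqP lE] /eqP xE]; rewrite lE xE (negPf bad).
  have [->|x0] := eqVneq (law_X2 x) 0.
    by rewrite invr0 !mulr0 law_Y1_ge0.
  rewrite mulrCA -[leRHS]mulr1 ler_wpM2l ?law_Y1_ge0 //.
  rewrite ler_pdivrMr ?mul1r; last by rewrite lt_def x0 law_X2_ge0.
  rewrite law_X2E [leRHS]big_mkcond [leLHS]big_mkcond.
  apply: ler_sum => v _; case: (xf v == x); rewrite ?andbT ?andbF //.
  by case: ifP => // _; rewrite mulr_ge0 ?invr_ge0.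
rewrite big_mkcond sum_omega.
apply: (@le_trans _ _ (\sum_w1 \sum_r1 M1%:R^-1 * P1 c r1 *
    (2 ^+ (N * C) * \sum_(y | dec1 c y == w1) law_Y1 y))); last first.
  under eq_bigr => w1 _ do rewrite -mulr_suml -mulr_sumr P1_sum mulr1 mulrCA.
  rewrite -!mulr_sumr ler_wpM2l ?exprn_ge0 // -[leRHS]mulr1 ler_wpM2l ?invr_ge0 //.
  by rewrite -law_Y1_sum1 (partition_big (dec1 c) xpredT).
apply: ler_sum => w1 _; rewrite exchange_big; apply: ler_sum => r1 _.
apply: le_trans (ler_wpM2l _ (main w1 r1)); last first.
  by rewrite mulr_ge0 ?invr_ge0.
pose F w2 r2 : R := P2 c r2 *
  (law_Y1 (yf w1 r1 (lf (w2, r2)) (xf (w2, r2))) / law_X2 (xf (w2, r2))).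
rewrite mulr_sumr [leRHS]big_mkcond (eq_bigr (fun v =>
    if dec1 c (yf w1 r1 (lf v) (xf v)) == w1 then
    M1%:R^-1 * P1 c r1 * (M2%:R^-1 * F v.1 v.2) else 0)) => [|[w2 r2] _];
  last first.
  by rewrite /F -!mulrA.
rewrite -(pair_bigA _ (fun w2 r2 =>
    if dec1 c (yf w1 r1 (lf (w2, r2)) (xf (w2, r2))) == w1 then
    M1%:R^-1 * P1 c r1 * (M2%:R^-1 * F w2 r2) else 0)) /=.
apply: ler_sum => w2 _; apply: ler_sum => r2 _.
rewrite yfE; case: ifP => // _.
have -> : inputs2 (w1, w2, r1, r2) = xf (w2, r2) by [].
by rewrite le_eqVlt /F; apply/orP; left; apply/eqP; ring.
Qed.

Lemma decoding_le (g : pred (omega c)) :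
  (forall o, (dec1 c (y1_of o) == w1_of o) && (dec2 c (y2_of o) == w2_of o) ->
     g o) ->
  1 - err_prob c <= \sum_(o | g o) p o.
Proof.
move=> imp_g; rewrite lerBlDr -prob_sum1 /err_prob.
rewrite (bigID g) /= lerD2l [leLHS]big_mkcond [leRHS]big_mkcond.
apply: ler_sum => o _; rewrite -negb_and.
case: ifPn => [ng|_]; last by case: ifP => // _; apply: prob_ge0.
by rewrite (contra (imp_g o) ng).
Qed.

(** A Cauchy-Schwarz argument: [ratio1_le] and [ratio2_le] bound the integrals of two inverse
    ratios, so their combination with weights s and 1/s is at least 2 on the event [E]. Optimising
    over s gives the product bound. *)
Lemma decoded_sqr_le : mutual_info p w2_of y1_of = 0 ->
  (1 - err_prob c) ^+ 2 <= 2 ^+ (N * (m + C)) / (M1 * M2)%:R.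
Proof.
move=> secret.
pose E o := (dec1 c (y1_of o) == w1_of o) && (dec2 c (y2_of o) == w2_of o).
have -> : 1 - err_prob c = \sum_(o | E o) p o.
  rewrite -prob_sum1 (bigID E) /= /err_prob.
  by under [X in _ - X]eq_bigl => o do rewrite -negb_and; rewrite addrK.
set P := \sum_(o | E o) p o.
have P0 : 0 <= P by apply: sumr_ge0 => o _; apply: prob_ge0.
pose a : R := 2 ^+ (N * C) / M1%:R; pose b : R := 2 ^+ (N * m) / M2%:R.
have a0 : 0 < a :> R by rewrite divr_gt0 ?exprn_gt0 ?ltr0n.
rewrite (_ : _ / _ = a * b); last first.
  by rewrite /a /b mulf_div -exprD natrM -mulnDr [(C + m)%N]addnC.
have amgm s : 0 < s -> 2 * P <= s * a + s^-1 * b.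
  move=> s0; apply: le_trans (lerD (ler_wpM2l (ltW s0) ratio1_le)
    (ler_wpM2l _ (ratio2_le secret))); last by rewrite invr_ge0 ltW.
  rewrite !mulr_sumr [X in X + _]big_mkcond [X in _ + X]big_mkcond -big_split /=.
  rewrite big_mkcond; apply: ler_sum => o _; rewrite /E.
  set A := law_Y1 _; set B := law_X2 _.
  have A0 : 0 <= A by apply: law_Y1_ge0.
  have B0 : 0 <= B by apply: law_X2_ge0.
  have po := prob_ge0 o.
  have t1 : 0 <= s * (p o * (A / B)) by rewrite !mulr_ge0 ?invr_ge0 // ltW.
  have t2 : 0 <= s^-1 * (p o * (B / A)) by rewrite !mulr_ge0 ?invr_ge0 // ltW.
  case: eqP => _; case: eqP => _ /=; rewrite ?addr0 ?add0r //.
  (* An outcome of positive probability makes both laws positive at its values, so the ratios are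
     genuine. *)
  have [->|po0] := eqVneq (p o) 0; first by rewrite !mul0r !mulr0 addr0.
  have p_gt : 0 < p o by rewrite lt_def po0.
  have A_gt : 0 < A.
    by apply: lt_le_trans p_gt _; rewrite /A /law_Y1 (bigD1 o) //= lerDl
      sumr_ge0 // => *; apply: prob_ge0.
  have B_gt : 0 < B.
    by apply: lt_le_trans p_gt _; rewrite /B /law_X2 (bigD1 o) //= lerDl
      sumr_ge0 // => *; apply: prob_ge0.
  (* The excess over [2 * p o] is a square over a positive number. *)
  have -> : s * (p o * (A / B)) + s^-1 * (p o * (B / A)) =
     2 * p o + p o * ((s * A - B) ^+ 2 / (s * A * B)).
    by field; rewrite !gt_eqF.
  by rewrite lerDl mulr_ge0 // mulr_ge0 ?sqr_ge0 // invr_ge0 !mulr_ge0 // ltW.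
have [->|P_neq] := eqVneq P 0.
  by rewrite expr0n /= /a /b !mulr_ge0 ?invr_ge0 ?exprn_ge0 ?ler0n.
have P_gt : 0 < P by rewrite lt_def P_neq.
(* the optimal s is P / a *)
have := amgm (P / a) (divr_gt0 P_gt a0).
rewrite divfK ?gt_eqF // mulr_natl mulr2n lerD2l invf_div mulrAC.
by rewrite ler_pdivlMr // expr2.
Qed.

End Converse.

(** * Secrecy of error-free codes with masked outputs *)

Lemma product_law_mutual_info0 {R : realType} {S A B : finType} {p : S -> R}
    {X : S -> A} {Y : S -> B} (f : A -> R) (g : B -> R) :
  \sum_s p s = 1 ->
  (forall a b, \sum_(s | (X s == a) && (Y s == b)) p s = f a * g b) ->
  mutual_info p X Y = 0.
Proof.
move=> p1 joint.
have lawX a : \sum_(s | X s == a) p s = f a * \sum_b g b.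
  by rewrite mulr_sumr (partition_big Y xpredT) //=; apply: eq_bigr => b _.
have lawY b : \sum_(s | Y s == b) p s = (\sum_a f a) * g b.
  rewrite mulr_suml (partition_big X xpredT) //=; apply: eq_bigr => a _.
  by rewrite -joint; apply: eq_bigl => s; rewrite andbC.
(* [f] and [g] are the marginals only up to constants, whose product is the total mass 1. *)
have fg1 : (\sum_a f a) * \sum_b g b = 1.
  by rewrite mulr_suml -p1 (partition_big X xpredT) //=; apply: eq_bigr.
apply: indep_mutual_info0 => a b; rewrite joint lawX lawY.
by rewrite -[LHS]mul1r -fg1; ring.
Qed.

Section ZeroErrorScheme.
Variables (R : realType) (m n C N : nat) (A1 A2 Z : finType) (z0 : Z).
Local Notation block := {ffun 'I_N -> sym (qmax m n)}.
Variables (u2 : A2 -> 'I_N -> sym (qmax m n)) (link : A2 -> 'I_N -> 'I_(2 ^ C)).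
Variable u1 : A1 -> Z -> 'I_N -> 'I_(2 ^ C) -> sym (qmax m n).
Variables (d1 : block -> A1) (d2 : block -> A2).
Variables (mask : A2 -> Z -> Z) (base : A1 -> Z -> block).
Hypothesis out1E : forall a1 a2 z,
  [ffun t => out1 (u1 a1 z t (link a2 t)) (u2 a2 t)] = base a1 (mask a2 z).
Hypothesis mask_inj : forall a2, injective (mask a2).
Hypothesis d1K : forall a1 z, d1 (base a1 z) = a1.
Hypothesis d2K : forall a2, d2 [ffun t => out2 (u2 a2 t)] = a2.

(** Transmitter 2 is deterministic and transmitter 1 draws its noise uniformly from [Z]. By [out1E],
    y_1 depends on w_2 only through the masked noise. *)
Definition scheme_code : Defs.code R m n C N #|A1| #|A2| :=
  @Defs.Code R m n C N #|A1| #|A2| Z unit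
    (fun=> #|Z|%:R^-1) (fun=> 1)
    (fun w _ t => u2 (enum_val w) t) (fun w _ t => link (enum_val w) t)
    (fun w z t f => u1 (enum_val w) z t (f t))
    (fun y => enum_rank (d1 y)) (fun y => enum_rank (d2 y)).

Local Notation c := scheme_code.

Lemma scheme_valid : valid_code c.
Proof.
have Z0 : (0 < #|Z|)%N by apply/card_gt0P; exists z0.
split; [|split].
- split=> [z|] /=; first by rewrite invr_ge0.
  by rewrite sum_card_const divff // pnatr_eq0 -lt0n.
- split=> [z|] /=; first exact: ler01.
  by rewrite sum_card_const card_unit mul1r.
- by move=> w1 z t f g fg /=; rewrite fg.
Qed.

Lemma scheme_Y1 (o : omega c) : @Y1 R m n C N _ _ c o =
  base (enum_val o.1.1.1) (mask (enum_val o.1.1.2) o.1.2).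
Proof. by case: o => [[[w1 w2] z] []]; rewrite -out1E. Qed.

Lemma scheme_Y2 (o : omega c) : @Y2 R m n C N _ _ c o =
  [ffun t => out2 (u2 (enum_val o.1.1.2) t)].
Proof. by case: o => [[[w1 w2] z] []]. Qed.

Lemma scheme_err_prob : err_prob c = 0.
Proof.
rewrite /err_prob big_pred0 // => o.
by rewrite scheme_Y1 scheme_Y2 /= d1K d2K !enum_valK !eqxx.
Qed.

Let prob1 : \sum_o @prob R m n C N _ _ c o = 1.
Proof.
apply: prob_sum1; first exact: scheme_valid.
  (* The message sets are inhabited because the decoders have values at the zero block. *)
  by apply/card_gt0P; exists (d1 [ffun=> 0]).
by apply/card_gt0P; exists (d2 [ffun=> 0]).
Qed.

(** y_2 is a function of w_2 alone; the second factor is its law. *)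
Lemma scheme_secret1 : mutual_info (@prob R m n C N _ _ c)
  (@W1 R m n C N _ _ c) (@Y2 R m n C N _ _ c) = 0.
Proof.
apply: (product_law_mutual_info0 (fun=> #|A1|%:R^-1) (fun y =>
  \sum_w2 \sum_(z : Z) if [ffun t => out2 (u2 (enum_val w2) t)] == y
    then #|A2|%:R^-1 / #|Z|%:R else 0) prob1) => w y.
rewrite big_mkcond sum_omega (bigD1 w) //= [X in _ + X]big1 => [|w1 w1w].
  rewrite addr0 mulr_sumr; apply: eq_bigr => w2 _.
  rewrite mulr_sumr; apply: eq_bigr => z _.
  rewrite (bigD1 tt) //= big1 ?addr0 => [|[]] //.
  rewrite scheme_Y2 /W1 /= eqxx /=.
  by case: ifP => _; rewrite ?mulr0 //; ring.
rewrite big1 // => w2 _; rewrite big1 // => z _; rewrite big1 // => t _.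
by rewrite /W1 /= (negPf w1w).
Qed.

(** For each w_2 the mask permutes [Z], so reindexing the uniform noise removes w_2 from the law of
    y_1. *)
Lemma scheme_secret2 : mutual_info (@prob R m n C N _ _ c)
  (@W2 R m n C N _ _ c) (@Y1 R m n C N _ _ c) = 0.
Proof.
apply: (product_law_mutual_info0 (fun=> #|A2|%:R^-1) (fun y =>
  \sum_w1 \sum_(z : Z) if base (enum_val w1) z == y
    then #|A1|%:R^-1 / #|Z|%:R else 0) prob1) => w y.
rewrite big_mkcond sum_omega mulr_sumr; apply: eq_bigr => w1 _.
rewrite (bigD1 w) //= [X in _ + X]big1 => [|w2 w2w].
  rewrite addr0 mulr_sumr [RHS](reindex_inj (mask_inj (enum_val w))).
  apply: eq_bigr => z _.
  rewrite (bigD1 tt) //= big1 ?addr0 => [|[]] //.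
  rewrite scheme_Y1 /W2 /= eqxx /=.
  by case: ifP => _; rewrite ?mulr0 //; ring.
rewrite big1 // => z _; rewrite big1 // => t _.
by rewrite /W2 /= (negPf w2w).
Qed.

End ZeroErrorScheme.

(** * Messages as bits placed on cells *)

Definition cells {N q} (S : {set 'I_N * 'I_q}) : finType :=
  {p : 'I_N * 'I_q | p \in S}.

Section Extension.
Context {N q : nat} {S : {set 'I_N * 'I_q}}.
Implicit Type w : {ffun cells S -> 'F_2}.

(** Zero off [S] and beyond the last level, so that signals on different supports can be added and
    shifted freely. *)
Definition extend w (t : 'I_N) (i : nat) : 'F_2 :=
  if insub i is Some j then
    if insub (t, j) is Some u then w u else 0
  else 0.

Lemma extend_val w (u : cells S) : extend w (val u).1 (val u).2 = w u.
Proof. by rewrite /extend valK; case: (val u) (valK u) => t j /= ->. Qed.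

Lemma extend_out w t (i : nat) :
  (forall j : 'I_q, i = j :> nat -> (t, j) \notin S) ->
  extend w t i = 0.
Proof.
move=> out; rewrite /extend; case: insubP => // j _ ji.
by rewrite insubF //; apply/negbTE/out; rewrite -ji.
Qed.

End Extension.

Lemma card_ord_interval q a b : (b <= q)%N ->
  #|[set i : 'I_q | (a <= i < b)%N]| = (b - a)%N.
Proof.
move=> bq; have [ab|ba] := leqP a b; last first.
  rewrite (eqP (_ : b - a == 0)%N) ?subn_eq0 1?ltnW //; apply/eqP.
  rewrite cards_eq0; apply/eqP/finset.setP => i; rewrite !inE.
  by apply/negbTE/negP => /andP[ai ib]; lia.
have lt (j : 'I_(b - a)) : (a + j < q)%N by have := ltn_ord j; lia.
rewrite -[RHS]card_ord -(card_imset _ (_ : injective (fun j => Ordinal (lt j)))).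
  apply: eq_card => i; rewrite inE; apply/idP/imsetP => [/andP[ai ib]|[j _ ->]].
    have lt' : (i - a < b - a)%N by lia.
    by exists (Ordinal lt') => //; apply: val_inj => /=; lia.
  by have := ltn_ord j; rewrite /=; lia.
by move=> j j' [/addnI e]; apply: val_inj.
Qed.

Lemma exists_bits_code C :
  exists (e : {ffun 'I_C -> 'F_2} -> 'I_(2 ^ C))
    (d : 'I_(2 ^ C) -> {ffun 'I_C -> 'F_2}), cancel e d.
Proof.
have cardE : #|{ffun 'I_C -> 'F_2}| = (2 ^ C)%N.
  by rewrite card_ffun !card_ord Fp_cast.
exists (fun f => cast_ord cardE (enum_rank f)).
exists (fun l => enum_val (cast_ord (esym cardE) l)) => f.
by rewrite cast_ordK enum_rankK.
Qed.

(** * The scheme with cancelled and jammed levels *)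

Section Scheme.
Variables (R : realType) (m n C N J : nat).
Hypotheses (lt_mn : (m < n)%N) (lt_n2m : (n < 2 * m)%N) (le_JN : (J <= N)%N).
Local Notation d := (n - m)%N.
Local Notation k := (2 * m - n)%N.
Local Notation c := (minn C k).
Local Notation q := (qmax m n).
Local Notation block := {ffun 'I_N -> sym q}.

(* The cells (time, level of the outputs of receiver 1) that carry data of
   transmitter 2 which transmitter 1 covers with noise. *)
Definition jammed : {set 'I_N * 'I_q} :=
  [set p : 'I_N * 'I_q | (p.1 < J)%N && (d + c <= p.2 < m)%N].
(** Besides the jammed cells, these are the c levels cancelled with the help of the link. All lie
    below level m of x_2, hence reach receiver 2; the top d levels stay silent, since receiver 1
    sees them in the clear. *)
Definition support2 : {set 'I_N * 'I_q} :=
  [set p : 'I_N * 'I_q | (d <= p.2 < d + c)%N] :|: jammed.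
(** Indexed by levels of y_1: the bit of cell (t, i) is sent on level i - d of x_1. *)
Definition support1 : {set 'I_N * 'I_q} :=
  [set p : 'I_N * 'I_q | (d <= p.2)%N] :\: jammed.

Local Notation msg S := {ffun cells S -> 'F_2}.

Lemma card_jammed : #|jammed| = (J * (k - c))%N.
Proof.
rewrite (_ : jammed = finset.setX [set t : 'I_N | (0 <= t < J)%N]
    [set i : 'I_q | (d + c <= i < m)%N]); last first.
  by apply/finset.setP => -[t i]; rewrite !inE.
rewrite cardsX !card_ord_interval ?subn0 //; last by rewrite qmaxE // ltnW.
by congr (_ * _)%N; have := geq_minr C k; lia.
Qed.

Lemma card_support2 : #|support2| = (N * c + J * (k - c))%N.
Proof.
rewrite /support2 cardsU card_jammed (_ : _ :&: _ = finset.set0) ?cards0 ?subn0.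
  rewrite (_ : [set p | _] = finset.setX [set: 'I_N]
    [set i : 'I_q | (d <= i < d + c)%N]); last first.
    by apply/finset.setP => -[t i]; rewrite !inE.
  rewrite cardsX cardsT card_ord card_ord_interval ?addKn // qmaxE //.
  by have := geq_minr C k; lia.
by apply/finset.setP => -[t i]; rewrite !inE /=; apply/negbTE; lia.
Qed.

Lemma card_support1 : #|support1| = (N * m - J * (k - c))%N.
Proof.
rewrite /support1 cardsD (finset.setIidPr _).
  rewrite card_jammed (_ : [set p | _] = finset.setX [set: 'I_N]
    [set i : 'I_q | (d <= i < q)%N]); last first.
    by apply/finset.setP => -[t i]; rewrite !inE /= ltn_ord andbT.
  by rewrite cardsX cardsT card_ord card_ord_interval // qmaxE // subKn // ltnW.
by apply/fintype.subsetP => -[t i]; rewrite !inE /=; lia.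
Qed.

Lemma card_msg (S : {set 'I_N * 'I_q}) : #|{: msg S}| = (2 ^ #|S|)%N.
Proof. by rewrite card_ffun card_ord Fp_cast // card_sig. Qed.

(** At each cell receiver 1 finds its own data, or noise plus data of transmitter 2, but never both;
    the sum with uniform noise is again uniform. *)
Lemma scheme_exists :
  exists c : Defs.code R m n C N (2 ^ (N * m - J * (k - c)))
                        (2 ^ (N * c + J * (k - c))),
    [/\ valid_code c, err_prob c = 0,
      mutual_info (@prob R m n C N _ _ c) (@W1 R m n C N _ _ c)
        (@Y2 R m n C N _ _ c) = 0 &
      mutual_info (@prob R m n C N _ _ c) (@W2 R m n C N _ _ c)
        (@Y1 R m n C N _ _ c) = 0].
Proof.
rewrite -card_support1 -card_support2 -!card_msg.
have [enc [dec encK]] := exists_bits_code C.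
pose bit (l : 'I_(2 ^ C)) i : 'F_2 := if insub i is Some j then dec l j else 0.
pose u2 (w : msg support2) t : sym q := column (extend w t).
pose link (w : msg support2) t := enc [ffun j : 'I_C => extend w t (d + j)].
(* Level i of x_1 arrives at level d + i of y_1, where link bit i equals the bit of x_2 to be
   removed. *)
pose u1 (a : msg support1) (z : msg jammed) t l : sym q := column (fun i =>
  extend a t (d + i) + extend z t (d + i)
   - if (i < c)%N then bit l i else 0).
pose base (a : msg support1) (z : msg jammed) : block :=
  [ffun t => column (fun i => extend a t i + extend z t i)].
pose mask (w : msg support2) (z : msg jammed) : msg jammed :=
  [ffun u : cells jammed => z u + extend w (val u).1 (val u).2].
pose d1 (y : block) : msg support1 :=
  [ffun u : cells support1 => level (y (val u).1) (val u).2].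
pose d2 (y : block) : msg support2 :=
  [ffun u : cells support2 => level (y (val u).1) (d + (val u).2)].
have qE : q = n by apply: qmaxE.
have mask_inj w : injective (mask w).
  move=> z z' /ffunP e; apply/ffunP => u; have := e u; rewrite !ffunE.
  exact: addIr.
have d1K a z : d1 (base a z) = a.
  apply/ffunP => u; rewrite !ffunE level_column // extend_val extend_out ?addr0 //.
  move=> j /val_inj <-; have := valP u; rewrite -surjective_pairing /=.
  by rewrite inE => /andP[].
have d2K w : d2 [ffun t => out2 (u2 w t)] = w.
  apply/ffunP => u; rewrite !ffunE level_out2 // addKn level_column // extend_val.
  suff -> : (d <= d + (val u).2 < n)%N by [].
  have := valP u; case: (val u) => t i; rewrite !inE /=; have := geq_minr C k; lia.
have out1E a w z : [ffun t => out1 (u1 a z t (link w t)) (u2 w t)] =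
    base a (mask w z).
  apply/ffunP => t; rewrite !ffunE; apply: level_inj => i iq.
  have ni : (i < n)%N by rewrite -qE.
  rewrite level_out1 // ni andbT !(level_column _ _ _ iq).
  pose j := Ordinal iq.
  have [di|id] := leqP d i; last first.
    rewrite !extend_out ?addr0 // => j' ij'; rewrite !inE /= -ij'; lia.
  rewrite level_column; last exact: leq_ltn_trans (leq_subr _ _) iq.
  rewrite (subnKC di).
  have bitE : (if (i - d < c)%N then bit (link w t) (i - d)%N else 0) =
      if (i < d + c)%N then extend w t i else 0.
    rewrite ltn_subLR //; case: ifP => // ic.
    have iC : (i - d < C)%N by have := geq_minl C k; lia.
    by rewrite /bit insubT encK ffunE /= subnKC.
  rewrite bitE.
  (* On a jammed cell no link bit is subtracted and x_2 shifts the noise. Elsewhere the noise is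
     zero, and x_2 is cancelled below level d + c and zero from there on. *)
  have [jam|njam] := boolP ((t, j) \in jammed).
    have -> : extend (mask w z) t i = extend z t i + extend w t i.
      by have := extend_val (mask w z) (Sub (t, j) jam); rewrite /= => ->;
        rewrite ffunE -(extend_val z).
    have : (d + c <= i)%N by move: jam; rewrite inE /=; lia.
    by rewrite leqNgt => /negPf ->; rewrite subr0 addrA.
  rewrite (extend_out (mask w z)) => [|j' ij']; last first.
    by rewrite (_ : j' = j) //; apply: val_inj.
  rewrite (extend_out z) => [|j' ij']; last first.
    by rewrite (_ : j' = j) //; apply: val_inj.
  case: ltnP => ic; first by rewrite subrK.
  rewrite (extend_out w) ?subr0 ?addr0 // => j' ij'.
  rewrite (_ : j' = j) ?inE; last exact: val_inj.
  move: njam; rewrite inE /=; lia.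
exists (scheme_code R m n C N _ _ _ u2 link u1 d1 d2); split.
- exact: (scheme_valid _ _ _ _ _ _ _ _ [ffun=> 0]).
- exact: (scheme_err_prob _ _ _ _ _ _ _ _ _ _ _ _ _ _ _ out1E).
- exact: (scheme_secret1 _ _ _ _ _ _ _ _ [ffun=> 0]).
- exact: (scheme_secret2 _ _ _ _ _ _ _ _ [ffun=> 0] _ _ _ _ _ _ _ out1E).
Qed.

End Scheme.

(** * From codes to achievable rates *)

Lemma powR2_natM {R : realType} (a b : nat) :
  powR 2 (a%:R * b%:R) = 2 ^+ (a * b) :> R.
Proof. by rewrite -natrM powR_mulrn. Qed.

(** If b < a, then 2^(N(a - b)) is at least 1 + N(a - b) ln 2, which exceeds K for the [N] chosen
    below. *)
Lemma rate_le_of_powR {R : realType} (a b K : R) (N0 : nat) :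
  (forall N, (N0 <= N)%N -> powR 2 (N%:R * a) <= K * powR 2 (N%:R * b)) ->
  a <= b.
Proof.
move=> bnd; rewrite leNgt; apply/negP => ba.
have ln2 : 0 < ln 2 :> R by rewrite ln_gt0 ?ltr1n.
have s0 : 0 < (a - b) * ln 2 by rewrite mulr_gt0 // subr_gt0.
pose N := (N0 + (Num.truncn (`|K| / ((a - b) * ln 2))).+1)%N.
have := bnd N (leq_addr _ _).
rewrite -ler_pdivrMr ?powR_gt0 // -powRB; last first.
  by apply/implyP => _; rewrite pnatr_eq0.
rewrite -mulrBr; apply/negP; rewrite -ltNge.
have -> : powR 2 (N%:R * (a - b)) = expR (N%:R * ((a - b) * ln 2)).
  by rewrite /powR pnatr_eq0 /= mulrA.
apply: lt_le_trans (expR_ge1Dx _); apply: le_lt_trans (ler_norm K) _.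
apply: (@lt_trans _ _ (N%:R * ((a - b) * ln 2))); last by rewrite ltrDr.
rewrite -ltr_pdivrMr //; apply: (lt_le_trans (truncnS_gt _)).
by rewrite ler_nat leq_addl.
Qed.

(** Error probability 1/2 is small enough: it costs a factor at most 4 in each bound on the message
    counts, and constant factors do not affect rates. *)
Lemma achievable_bounds {R : realType} {m n C : nat} {r : R * R} :
  (m < n)%N -> (n < 2 * m)%N -> achievable m n C r ->
  [/\ r.1 <= m%:R, r.2 <= (2 * m - n)%:R & r.1 + r.2 <= m%:R + C%:R].
Proof.
move=> mn n2m [r1_ge0 [r2_ge0 /(_ 2^-1)]].
rewrite invr_gt0 ltr0n => /(_ isT) [N0 ach].
have bounds N : (N0 <= N)%N ->
  [/\ powR 2 (N%:R * r.1) <= 4 * 2 ^+ (N * m),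
      powR 2 (N%:R * r.2) <= 4 * 2 ^+ (N * (2 * m - n)) &
      powR 2 (N%:R * (r.1 + r.2)) <= 4 * 2 ^+ (N * (m + C)) :> R].
  move=> /ach[M1 [M2 [c [c_valid [M1_ge [M2_ge [err [_ secret]]]]]]]].
  have M1_gt0 : 0 < M1%:R :> R by rewrite (lt_le_trans _ M1_ge) ?powR_gt0.
  have M2_gt0 : 0 < M2%:R :> R by rewrite (lt_le_trans _ M2_ge) ?powR_gt0.
  have M1_gt0' : (0 < M1)%N by rewrite -(ltr0n R).
  have M2_gt0' : (0 < M2)%N by rewrite -(ltr0n R).
  have half : 2^-1 <= 1 - err_prob c by lra.
  split.
  - apply: le_trans M1_ge _.
    have := decoded1_le mn c_valid M2_gt0'.
    move=> /(le_trans (decoding_le c_valid M1_gt0' M2_gt0' _ _)).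
    move=> /(_ (fun o h => proj1 (andP h))).
    move=> /(le_trans half).
    rewrite ler_pdivlMr // => le1; lra.
  - apply: le_trans M2_ge _.
    have := decoded2_le mn c_valid M1_gt0' M2_gt0' secret.
    move=> /(le_trans (decoding_le c_valid M1_gt0' M2_gt0' _ _)).
    move=> /(_ (fun o h => proj2 (andP h))).
    move=> /(le_trans half).
    rewrite ler_pdivlMr // => le2; lra.
  - rewrite mulrDr powRD; last by rewrite pnatr_eq0 implybT.
    apply: (@le_trans _ _ (M1%:R * M2%:R)); first by rewrite ler_pM ?powR_ge0.
    have := decoded_sqr_le mn c_valid M1_gt0' M2_gt0' secret.
    rewrite natrM ler_pdivlMr ?mulr_gt0 // => le12.
    have : 4^-1 * (M1%:R * M2%:R) <= 2 ^+ (N * (m + C)) :> R.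
      apply: le_trans le12; rewrite ler_wpM2r ?mulr_ge0 //.
      have -> : 4^-1 = 2^-1 ^+ 2 :> R by field.
      by rewrite ler_sqr ?nnegrE ?invr_ge0 // (le_trans _ half) ?invr_ge0.
    by lra.
split; last rewrite -natrD.
all: apply: (@rate_le_of_powR _ _ _ 4 N0) => N /bounds[b1 b2 b3].
all: by rewrite powR2_natM.
Qed.

(** Take the least number [J] of jammed channel uses that gives transmitter 2 its rate. It
    overshoots by fewer than k - c bits, and for large [N] the slack in the sum rate pays for
    them. *)
Lemma achievable_interior {R : realType} {m n C : nat} {r : R * R} :
  (m < n)%N -> (n < 2 * m)%N -> 0 <= r.1 -> 0 <= r.2 ->
  r.1 <= m%:R -> r.2 <= (2 * m - n)%:R -> r.1 + r.2 < m%:R + C%:R ->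
  achievable m n C r.
Proof.
move=> mn n2m r1_ge0 r2_ge0 r1_le r2_le sum_lt.
split=> //; split=> // eps eps_gt0.
set k := (2 * m - n)%N in r2_le *.
pose slack := m%:R + C%:R - (r.1 + r.2).
have slack_gt0 : 0 < slack by rewrite subr_gt0.
exists (Num.truncn (k%:R / slack)).+1 => N N_ge.
have N_slack : k%:R <= N%:R * slack.
  rewrite -ler_pdivrMr //; apply/ltW/(lt_le_trans (truncnS_gt _)).
  by rewrite ler_nat.
have ck : (minn C k <= k)%N by apply: geq_minr.
pose enough J := N%:R * r.2 <= (N * minn C k + J * (k - minn C k))%:R.
have enoughN : enough N.
  rewrite /enough -mulnDr subnKC // natrM.
  by rewrite ler_wpM2l.
have exJ : exists J, enough J by exists N.
case: (ex_minnP exJ) => J J_enough J_min.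
have JN : (J <= N)%N by apply: J_min.
exists (2 ^ (N * m - J * (k - minn C k)))%N.
exists (2 ^ (N * minn C k + J * (k - minn C k)))%N.
have [c [c_valid c_err sec1 sec2]] := scheme_exists R m n C N J mn n2m JN.
exists c; split=> //; rewrite c_err !natrX -!powR_mulrn //.
split; [|split; [|by rewrite ltW]]; apply: ler_powR; rewrite ?ler1n //.
have km : (k <= m)%N by rewrite /k; lia.
have Jk : (J * (k - minn C k) <= N * m)%N.
  by rewrite leq_mul // (leq_trans (leq_subr _ _)).
rewrite natrB // lerBrDr.
(* Without jamming transmitter 1 keeps all N m bits. *)
case: J J_enough J_min JN c c_valid c_err sec1 sec2 Jk => [|J] _ J_min *.
  by rewrite mul0n addr0 natrM ler_wpM2l.
(* [J] is now one less than the minimum. If k < C, then c = k and jamming costs nothing. *)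
have : ~~ enough J by apply/negP => /J_min; rewrite ltnn.
rewrite /enough -ltNge; have [Ck|kC] := leqP C k; last first.
  by rewrite subnn !muln0 addr0 natrM => _; rewrite ler_wpM2l.
rewrite natrD !natrM mulrSr natrB // => few.
have C0 : 0 <= C%:R :> R by [].
rewrite /slack in N_slack.
have -> : N%:R * r.1 = N%:R * m%:R + N%:R * C%:R - N%:R * r.2
   - N%:R * (m%:R + C%:R - (r.1 + r.2)) by ring.
lra.
Qed.

(** * Closure and the capacity region *)

Lemma closure_pairP {R : realType} (A : set (R * R)) (r : R * R) :
  closure A r <->
  forall e, 0 < e -> exists2 s, A s & `|r.1 - s.1| < e /\ `|r.2 - s.2| < e.
Proof.
split=> [Ar e e0|Ar B /nbhs_ballP[e /= e0 eB]].
  have [s [As [/= s1 s2]]] := Ar (ball r e) (nbhsx_ballx _ _ e0).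
  by exists s.
by have [s As [s1 s2]] := Ar e e0; exists s; split => //; apply: eB; split.
Qed.

Local Open Scope classical_set_scope.

Theorem theorem2 (R : realType) (m n C : nat) :
  (1 <= m)%N ->
  1 < (n%:R / m%:R : R) < 2 ->
  @secrecy_capacity_region R m n C =
  [set r : R * R | [/\ 0 <= r.1, 0 <= r.2, r.1 <= m%:R,
                      r.2 <= 2 * m%:R - n%:R & r.1 + r.2 <= m%:R + C%:R]].
Proof.
move=> m_ge1 /andP[].
have m_gt0 : 0 < m%:R :> R by rewrite ltr0n.
rewrite ltr_pdivlMr // mul1r ltr_nat => mn.
rewrite ltr_pdivrMr // -natrM ltr_nat => n2m.
rewrite -natrB 1?ltnW //; apply/seteqP; split => r; last first.
  move=> [r1_ge0 r2_ge0 r1_le r2_le sum_le].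
  apply/closure_pairP => e e0.
  (* The point is scaled by [1 - t] to make the sum constraint strict. The 1 in [S] keeps it
     positive at the origin, and [t <= 2^-1] keeps the scaled rates nonnegative. *)
  pose S := r.1 + r.2 + 1.
  have S_gt0 : 0 < S by rewrite /S; lra.
  pose t := Num.min (e / (2 * S)) 2^-1.
  have t_gt0 : 0 < t by rewrite lt_min invr_gt0 ltr0n andbT divr_gt0 // mulr_gt0.
  have t_le : t <= 2^-1 by rewrite ge_min lexx orbT.
  have tS : t * S < e.
    apply: (@le_lt_trans _ _ (e / (2 * S) * S)).
      by rewrite ler_wpM2r ?ge_min ?lexx // ltW.
    by rewrite invfM mulrA divfK ?gt_eqF //; lra.
  have bnd x : 0 <= x -> x <= r.1 + r.2 -> `|x - (1 - t) * x| < e.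
    move=> x0 xS; rewrite (_ : _ - _ = t * x); last ring.
    rewrite ger0_norm ?mulr_ge0 ?(ltW t_gt0) //; apply: le_lt_trans tS.
    by rewrite ler_wpM2l ?(ltW t_gt0) // /S; lra.
  exists ((1 - t) * r.1, (1 - t) * r.2); last by split; apply: bnd => //=; lra.
  have shrink x : 0 <= x -> 0 <= (1 - t) * x <= x.
    move=> x0; rewrite mulr_ge0 ?subr_ge0 //=; last by lra.
    by rewrite -[leRHS]mul1r ler_wpM2r //; lra.
  have /andP[? ?] := shrink _ r1_ge0; have /andP[? ?] := shrink _ r2_ge0.
  apply: achievable_interior => //=; first exact: le_trans r1_le.
    exact: le_trans r2_le.
  rewrite -mulrDr; have [->|s0] := eqVneq (r.1 + r.2) 0.
    (* At the origin scaling changes nothing; strictness comes from m > 0. *)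
    by rewrite mulr0 ltr_pwDl.
  have s_gt0 : 0 < r.1 + r.2 by rewrite lt_def s0 addr_ge0.
  apply: lt_le_trans sum_le; rewrite -[ltRHS]mul1r ltr_pM2r //; lra.
move=> /closure_pairP near_r.
(* The factor 2 serves the sum rate, where both coordinates contribute an error e. *)
have le_of x b : (forall e, 0 < e -> x <= b + 2 * e) -> x <= b :> R.
  move=> xb; apply/ler_addgt0Pr => e e0.
  by have := xb (e / 2); rewrite divr_gt0 // => /(_ isT); lra.
split; apply: le_of => e e0;
  have [s /= As [s1 s2]] := near_r e e0;
  have [s1_ge0 [s2_ge0 _]] := As;
  have [s1_le s2_le ssum_le] := achievable_bounds mn n2m As;
  move: s1 s2; rewrite !ltr_norml => /andP[? ?] /andP[? ?]; lra.
Qed.
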